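(* Let $R$ be a ring with identity and let $U$ be an artinian uniserial right $R$-module. Then $\mathrm{Add}(U)$ is a covering class if and only if it is closed under direct limits.
   Context: A module is uniserial if its lattice of submodules is linearly ordered by inclusion. $\mathrm{Add}(U)$ denotes the class of all right $R$-modules isomorphic to a direct summand of a direct sum $U^{(X)}$ of copies of $U$, $X$ any set. An $\mathrm{Add}(U)$-precover of a right $R$-module $A$ is a homomorphism $f\colon C\to A$ with $C\in\mathrm{Add}(U)$ such that every homomorphism $C'\to A$ with $C'\in\mathrm{Add}(U)$ factors through $f$; it is an $\mathrm{Add}(U)$-cover if moreover every endomorphism $h$ of $C$ with $fh=f$ is an automorphism. $\mathrm{Add}(U)$ is covering if every right $R$-module has an $\mathrm{Add}(U)$-cover. Closed under direct limits means that the direct limit of any directed system of modules in $\mathrm{Add}(U)$ belongs to $\mathrm{Add}(U)$. *)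

(* Defs.v *)
From HB Require Import structures.
From mathcomp Require Import all_boot all_order all_algebra.
From mathcomp Require Import boolp classical_sets functions cardinality.
Set Implicit Arguments.
Unset Strict Implicit.
Unset Printing Implicit Defensive.
Import Order.Theory GRing.Theory.
Local Open Scope classical_set_scope.
Local Open Scope ring_scope.

(* A right R-module is a left module over the converse ring R^c: x r is
   written r *: x with r : R^c. The ring R may be trivial. *)
Notation rmodType R := (lmodType R^c).

Section DirectSum.
Variables (R : pzRingType) (X : Type) (U : lmodType R).

Definition finite_supp : {pred X -> U} :=
  [pred f : X -> U | `[< finite_set [set x | f x <> 0] >]].

Lemma finite_supp_submod_closed : GRing.submod_closed finite_supp.
Proof.
split=> [|a f g]; rewrite !inE.
  by apply: (@sub_finite_set _ _ set0) => // x /=; apply.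
move=> finf fing.
have : finite_set ([set x | f x <> 0] `|` [set x | g x <> 0]).
  by rewrite finite_setU.
apply: sub_finite_set => x /= fgx.
have [fx0|fx0] := pselect (f x = 0); last by left.
have [gx0|gx0] := pselect (g x = 0); last by right.
by exfalso; apply: fgx; change (a *: f x + g x = 0); rewrite fx0 gx0 scaler0 addr0.
Qed.

HB.instance Definition _ :=
  GRing.isSubmodClosed.Build R (X -> U) finite_supp finite_supp_submod_closed.

(* The direct sum U^(X), as a submodule of the module X -> U of all functions. *)
Record dsum := DSum { dsum_fun :> X -> U; _ : dsum_fun \in finite_supp }.

HB.instance Definition _ := [isSub for dsum_fun].
HB.instance Definition _ := [Choice of dsum by <:].
HB.instance Definition _ := [SubChoice_isSubLmodule of dsum by <:].

End DirectSum.

Section Modules.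
Variable R : pzRingType.

Definition uniserial (U : rmodType R) : Prop :=
  forall N K : {pred U}, GRing.submod_closed N -> GRing.submod_closed K ->
    {subset N <= K} \/ {subset K <= N}.

Definition artinian (U : rmodType R) : Prop :=
  forall N : nat -> {pred U},
    (forall n, GRing.submod_closed (N n)) ->
    (forall n, {subset N n.+1 <= N n}) ->
    exists n, forall m, (n <= m)%N -> N m =i N n.

(* M is isomorphic to a direct summand of U^(X): there are N and an
   isomorphism from M (+) N onto U^(X). *)
Definition Add (U M : rmodType R) : Prop :=
  exists (X : Type) (N : rmodType R)
    (f : {linear (M * N)%type -> dsum X U}), bijective f.

Variable C : rmodType R -> Prop.

Definition is_precover (A B : rmodType R) (f : {linear B -> A}) : Prop :=
  C B /\
  forall (B' : rmodType R) (g : {linear B' -> A}), C B' ->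
    exists h : {linear B' -> B}, f \o h =1 g.

Definition is_cover (A B : rmodType R) (f : {linear B -> A}) : Prop :=
  is_precover f /\ forall h : {linear B -> B}, f \o h =1 f -> bijective h.

Definition covering : Prop :=
  forall A : rmodType R, exists (B : rmodType R) (f : {linear B -> A}), is_cover f.

End Modules.

Section DirectLimits.
Variables (R : pzRingType) (d : Order.disp_t) (I : preorderType d).
Variables (M : I -> rmodType R).
Variable (phi : forall i j : I, (i <= j)%O -> {linear M i -> M j}).

Definition directed_system : Prop :=
  [/\ inhabited I,
      forall i j : I, exists k : I, (i <= k)%O /\ (j <= k)%O,
      forall (i : I) (ii : (i <= i)%O), phi ii =1 id
    & forall (i j k : I) (ij : (i <= j)%O) (jk : (j <= k)%O) (ik : (i <= k)%O),
        phi jk \o phi ij =1 phi ik].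

Definition cocone (L : rmodType R) (g : forall i, {linear M i -> L}) : Prop :=
  forall (i j : I) (ij : (i <= j)%O), g j \o phi ij =1 g i.

Definition is_direct_limit (L : rmodType R) (g : forall i, {linear M i -> L}) : Prop :=
  cocone g /\
  forall (L' : rmodType R) (g' : forall i, {linear M i -> L'}), cocone g' ->
    exists h : {linear L -> L'},
      (forall i, h \o g i =1 g' i) /\
      forall h' : {linear L -> L'}, (forall i, h' \o g i =1 g' i) -> h' =1 h.

End DirectLimits.

Definition closed_under_direct_limits (R : pzRingType)
    (C : rmodType R -> Prop) : Prop :=
  forall (d : Order.disp_t) (I : preorderType d) (M : I -> rmodType R)
    (phi : forall i j : I, (i <= j)%O -> {linear M i -> M j}),
    directed_system phi -> (forall i, C (M i)) ->
    forall (L : rmodType R) (g : forall i, {linear M i -> L}),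
      is_direct_limit phi g -> C L.

(* Main.v *)
Require Import Defs.
From HB Require Import structures.
From mathcomp Require Import all_boot all_order all_algebra.
From mathcomp Require Import boolp classical_sets functions cardinality fsbigop.

(** Let s generate the least nonzero submodule of U (s = 0 if U = 0); it exists
    because U is artinian and uniserial.  An injective endomorphism of U is
    bijective by the descending chain condition, and a nonzero kernel contains
    s, so an endomorphism that does not kill s is an automorphism: the
    endomorphisms killing s play the role of the radical.  The descending chain condition also gives among them an f
    whose kernel is least [least_kernel].  Everything depends on whether this f
    is locally nilpotent, that is, whether each u in U is killed by some power
    of f.  If it is, Add(U) is both covering and closed under direct limits; if
    it is not, Add(U) is neither.

    Suppose f is locally nilpotent.  An endomorphism killing s maps ker f^(n+1)
    into ker f^n [kernel_le_image], so an endomorphism of U^(X) congruent to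
    the identity modulo the radical is bijective [bijective_of_radical].  This
    makes an exchange argument work: a maximal independent family of maps from
    U to U^(Y) is a basis of U^(Y) [maximal_independent_spans].  Hence for each
    submodule K of U^(Y) there is a decomposition of U^(Y) into a submodule of
    K and a module C isomorphic to some U^(X), such that all maps from U to the
    intersection of C and K kill s [radical_complement].  Take for K the kernel
    of the canonical map U^(Hom(U, A)) -> A: its restriction to C is a cover of
    A.  Take for K the kernel of a presentation U^(Y) -> L of a direct limit
    L of modules in Add(U): each element of K is fixed by some endomorphism of
    U^(Y) with values in K, this forces C and K to intersect trivially, and so
    L is isomorphic to C.

    Suppose f^n u0 <> 0 for all n.  Then f is surjective
    [nonnilpotent_surjective].  Let V be the union of the kernels of the f^n;
    it does not contain u0.  Over an index set Y one constructs a module A with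
    maps e_y : U -> A and, for each sequence phi in Y, a map g_phi : U -> A
    that equals the infinite sum of the e_(phi i) f^i on V, where that sum is
    finite at each point.  Suppose C -> A is a cover, with C a direct summand
    of U^(X).  A map from U to its kernel kills s, hence ker f, hence factors
    through f; iterating, it kills V.  So a lift of g_phi to C is determined on
    V by lifts of the e_y.  When Y has more elements than the set of sequences
    in U, a diagonal choice of phi makes infinitely many coordinates of that
    lift nonzero on V.  A coordinate that kills u0 kills V, which is contained
    in the submodule generated by u0; so the image of u0 in U^(X) has infinite
    support, which is absurd [no_cover].  Hence Add(U) is not covering.  But A
    is also the direct limit of a chain of modules isomorphic to direct sums of
    copies of U; if Add(U) were closed under direct limits, A would be in
    Add(U) and its identity map would be a cover. *)

Set Implicit Arguments.
Unset Strict Implicit.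
Unset Printing Implicit Defensive.
Import Order.Theory GRing.Theory.
Local Open Scope classical_set_scope.
Local Open Scope ring_scope.

(** * Linear maps and direct sums *)

Section LinearMaps.
Variable R : pzRingType.
Implicit Types U V W : lmodType R.

Lemma linear_of U V (f : U -> V) :
  linear f -> exists g : {linear U -> V}, g =1 f.
Proof.
move=> lf; pose F : {linear U -> V} :=
  HB.pack f (GRing.isLinear.Build R U V *:%R f lf).
by exists F.
Qed.

Lemma linear_inv U V (f : {linear U -> V}) :
  bijective f -> exists g : {linear V -> U}, cancel f g /\ cancel g f.
Proof.
move=> [g fK gK].
have [|h hE] := @linear_of V U g.
  by move=> a x y; apply: (can_inj fK); rewrite linearP !gK.
by exists h; split=> x; rewrite hE.
Qed.

Lemma linear_factor U V W (p : {linear U -> V}) (t : {linear U -> W}) :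
  (forall v, exists u, p u = v) -> (forall u, p u = 0 -> t u = 0) ->
  exists h : {linear V -> W}, forall u, h (p u) = t u.
Proof.
move=> /choice[q qK] kert.
have tE u u' : p u = p u' -> t u = t u'.
  move=> e; apply/eqP; rewrite -subr_eq0 -linearB; apply/eqP/kert.
  by rewrite linearB e subrr.
have [|h hE] := @linear_of V W (t \o q).
  by move=> a x y /=; rewrite -linearP; apply: tE; rewrite linearP !qK.
by exists h => u; rewrite hE; apply: tE; rewrite qK.
Qed.

End LinearMaps.

Section DirectSumTheory.
Variables (R : pzRingType) (X : Type) (U : lmodType R).
Implicit Types (a b : dsum X U) (x : X).

Lemma dsum_ext a b : a =1 b -> a = b.
Proof. by move=> ab; apply/val_inj/funext. Qed.

Lemma dsum_finite a : finite_set [set x | a x <> 0].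
Proof. by case: a => f memf /=; move: memf; rewrite inE. Qed.

Definition dcoord x a : U := a x.
Fact dcoord_is_linear x : linear (dcoord x).
Proof. by []. Qed.
HB.instance Definition _ x :=
  GRing.isLinear.Build R (dsum X U) U *:%R (dcoord x) (dcoord_is_linear x).

Lemma dsumD a b x : (a + b) x = a x + b x. Proof. by []. Qed.
Lemma dsumB a b x : (a - b) x = a x - b x. Proof. by []. Qed.
Lemma dsum0 x : (0 : dsum X U) x = 0. Proof. by []. Qed.
Lemma dsumZ (r : R) a x : (r *: a) x = r *: a x. Proof. by []. Qed.

Definition delta x (u : U) (y : X) : U := if `[< y = x >] then u else 0.

Fact delta_finite x u : delta x u \in @finite_supp R X U.
Proof.
rewrite inE; apply: (@sub_finite_set _ _ [set x]) => //.
by move=> y /=; rewrite /delta; case: asboolP.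
Qed.

Definition din x (u : U) : dsum X U := DSum (delta_finite x u).

Lemma dinE x u : din x u x = u.
Proof. by rewrite /= /delta; case: asboolP. Qed.

Lemma dinN x u y : y <> x -> din x u y = 0.
Proof. by rewrite /= /delta; case: asboolP. Qed.

Fact din_is_linear x : linear (din x).
Proof.
move=> r u v; apply: dsum_ext => y; rewrite dsumD dsumZ.
have [->|yx] := pselect (y = x); first by rewrite !dinE.
by rewrite !dinN // scaler0 addr0.
Qed.
HB.instance Definition _ x :=
  GRing.isLinear.Build R U (dsum X U) *:%R (din x) (din_is_linear x).

(** The generators are only those occurring in a, so that a bound on the
    coordinates of a or on its support is available for each of them. *)
Lemma dsum_ind_supp a (P : dsum X U -> Prop) :
  P 0 -> (forall b c, P b -> P c -> P (b + c)) ->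
  (forall x, P (din x (a x))) -> P a.
Proof.
move=> P0 PD Pin.
have /(@finite_seqP {classic X})[l lE] := dsum_finite a.
have al x : a x <> 0 -> x \in (l : seq {classic X}).
  by move=> ax; have : [set x | a x <> 0] x by []; rewrite lE.
suff : forall b, (forall x, b x <> 0 -> x \in l /\ b x = a x) -> P b.
  by apply=> x ax; split=> //; exact: al.
elim: l {lE al} => [|y l IH] b bl.
  suff -> : b = 0 by [].
  by apply: dsum_ext => x; apply: contrapT => /bl[].
rewrite -(subrK (din y (b y)) b); apply: PD.
  apply: IH => x; rewrite dsumB => bx.
  have [xy|xy] := pselect (x = y); first by rewrite xy dinE subrr in bx.
  have := bl x; rewrite dinN // subr0 in bx *.
  by move=> /(_ bx)[]; rewrite (@in_cons {classic X}) => /orP[/eqP|].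
have [by0|/bl[_ ->]//] := pselect (b y = 0).
by rewrite by0 linear0.
Qed.

Lemma dsum_ind (P : dsum X U -> Prop) :
  P 0 -> (forall a b, P a -> P b -> P (a + b)) -> (forall x u, P (din x u)) ->
  forall a, P a.
Proof. by move=> P0 PD Pin a; apply: dsum_ind_supp. Qed.

Lemma dsum_eq (M : lmodType R) (f g : {linear dsum X U -> M}) :
  (forall x u, f (din x u) = g (din x u)) -> f =1 g.
Proof.
move=> fg; apply: dsum_ind => [|a b ea eb|//]; first by rewrite !linear0.
by rewrite !linearD ea eb.
Qed.

Section Lift.
Variables (M : lmodType R) (t : X -> {linear U -> M}).

(** The universal property of the direct sum.  The sum over all of X makes sense
    because a has finite support. *)
Definition dlift a : M :=
  \sum_(x \in [set: {classic X}]) t x (a x).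

Fact dlift_is_linear : linear dlift.
Proof.
move=> r a b; rewrite /dlift.
have sub c d : [set: {classic X}] `&` [set x | t x (c x) != 0] `<=` d ->
  \sum_(x \in [set: {classic X}]) t x (c x) =
  \sum_(x \in d) t x (c x).
  move=> sd; apply: esym; apply: fsbig_widen => // x /= [_ xd].
  apply/eqP; apply: contrapT => /negP ne; apply: xd; exact: sd.
set d := [set x : {classic X} | a x <> 0] `|` [set x : {classic X} | b x <> 0].
have find : finite_set d by rewrite finite_setU; split; exact: dsum_finite.
have dP c : (forall x, a x = 0 -> b x = 0 -> c x = 0) ->
    [set: {classic X}] `&` [set x | t x (c x) != 0] `<=` d.
  move=> cab x /= [_ /eqP tc].
  apply: contrapT => /not_orP[/contrapT ax /contrapT bx].
  by apply: tc; rewrite cab // linear0.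
rewrite !(sub _ d); [|apply: dP..].
- rewrite !fsbig_finite //= scaler_sumr -big_split /=.
  by apply: eq_bigr => x _; rewrite -linearP.
- by [].
- by [].
- by move=> x ax bx; rewrite dsumD dsumZ ax bx scaler0 addr0.
Qed.
HB.instance Definition _ :=
  GRing.isLinear.Build R (dsum X U) M *:%R dlift dlift_is_linear.

Lemma dlift_in x u : dlift (din x u) = t x u.
Proof.
rewrite /dlift -(@fsbig_widen {classic X} _ _ _ [set x]) //.
  by rewrite fsbig_set1 dinE.
by move=> y [_ yx]; rewrite /preimage /mkset dinN // linear0.
Qed.

End Lift.
End DirectSumTheory.

(** * Endomorphisms of an artinian uniserial module *)

Section Uniserial.
Variables (R : pzRingType) (U : rmodType R).
Implicit Types (x y u : U) (f g : {linear U -> U}).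

Fixpoint lpow f n : {linear U -> U} :=
  if n is m.+1 then [the {linear U -> U} of f \o lpow f m] else idfun.

Lemma lpowE f n : lpow f n =1 iter n f.
Proof. by elim: n => [|n IH] x //=; rewrite IH. Qed.

Lemma lpowSr f n x : lpow f n.+1 x = lpow f n (f x).
Proof. by rewrite !lpowE iterSr. Qed.

Lemma lpowD f m n x : lpow f (m + n) x = lpow f m (lpow f n x).
Proof. by rewrite !lpowE iterD. Qed.

Definition ker_pred (V : rmodType R) (f : {linear U -> V}) : {pred U} :=
  [pred x | f x == 0].

Lemma ker_pred_closed (V : rmodType R) (f : {linear U -> V}) :
  GRing.submod_closed (ker_pred f).
Proof.
split=> [|r x y]; rewrite !inE ?linear0 // linearP.
by move=> /eqP -> /eqP ->; rewrite scaler0 addr0.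
Qed.

Definition im_pred f : {pred U} := [pred x | `[< exists y, f y = x >]].

Lemma im_pred_closed f : GRing.submod_closed (im_pred f).
Proof.
split=> [|r x y]; rewrite !inE; first by exists 0; rewrite linear0.
by move=> [x' <-] [y' <-]; exists (r *: x' + y'); rewrite linearP.
Qed.

Definition cyc_pred x : {pred U} :=
  [pred y | `[< exists r : R^c, y = r *: x >]].

Lemma cyc_pred_closed x : GRing.submod_closed (cyc_pred x).
Proof.
split=> [|r y z]; rewrite !inE; first by exists 0; rewrite scale0r.
by move=> [a ->] [b ->]; exists (r * a + b); rewrite scalerDl scalerA.
Qed.

Lemma artinian_minimal (T : Type) (F : T -> {pred U}) :
  artinian U -> (forall t, GRing.submod_closed (F t)) -> T ->
  exists t0, forall t, {subset F t <= F t0} -> {subset F t0 <= F t}.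
Proof.
move=> artU clF t0; apply: contrapT => noF.
have /choice[nxt nxtP] t :
    exists t', {subset F t' <= F t} /\ ~ {subset F t <= F t'}.
  apply: contrapT => not; apply: noF; exists t => t' t't.
  apply: contrapT => tt'.
  by apply: not; exists t'.
have [|n|n stat] := artU (fun n => F (iter n nxt t0)).
- by move=> n; exact: clF.
- by have [] := nxtP (iter n nxt t0).
- have [_] := nxtP (iter n nxt t0); apply=> x xn.
  by have /(_ x) := stat n.+1 (leqnSn n); rewrite xn => ->.
Qed.

Lemma bijective_of (V W : rmodType R) (g : {linear V -> W}) :
  (forall v, g v = 0 -> v = 0) -> (forall w, exists v, g v = w) -> bijective g.
Proof.
move=> ginj /choice[h hK]; exists h => // v.
apply/eqP; rewrite -subr_eq0; apply/eqP/ginj.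
by rewrite linearB hK subrr.
Qed.

Hypotheses (artU : artinian U) (uniU : uniserial U).

Lemma uniserial_elt x y :
  (exists r : R^c, y = r *: x) \/ (exists r : R^c, x = r *: y).
Proof.
have [xy|yx] := uniU (cyc_pred_closed x) (cyc_pred_closed y).
- right; have /xy : x \in cyc_pred x by rewrite inE; exists 1; rewrite scale1r.
  by rewrite inE.
- left; have /yx : y \in cyc_pred y by rewrite inE; exists 1; rewrite scale1r.
  by rewrite inE.
Qed.

(** The case U = 0, where s = 0, is kept so that the rest applies to any U. *)
Lemma socle_generator :
  exists s, (forall x, x <> 0 -> exists r : R^c, r *: x = s) /\
            ((exists x, x <> 0) -> s <> 0).
Proof.
have [[x0 x0n]|U0] := pselect (exists x : U, x <> 0); last first.
  by exists 0; split=> // x xn; case: U0; exists x.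
pose F (t : {x : U | x <> 0}) := cyc_pred (sval t).
have [t|[s sn] smin] := @artinian_minimal _ F artU _ (exist _ x0 x0n).
  exact: cyc_pred_closed.
exists s; split=> // x xn; have [[r ->]|[r xr]] := uniserial_elt x s.
  by exists r.
suff /smin/(_ s) : {subset F (exist _ x xn) <= F (exist _ s sn)}.
  rewrite !inE /= => /(_ _)[|a ->]; last by exists a.
  by exists 1; rewrite scale1r.
by move=> y; rewrite !inE /= xr => -[a ->]; exists (a * r); rewrite scalerA.
Qed.

(** The images of the powers of g become stationary: g^n y = g^n (g x) for some
    n and x, and g^n cancels. *)
Lemma injective_endo_bijective g : (forall x, g x = 0 -> x = 0) -> bijective g.
Proof.
move=> ginj; apply: bijective_of => // y.
have [n|n z|n stat] := artU (N := fun n => im_pred (lpow g n)).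
- exact: im_pred_closed.
- by rewrite !inE => -[x <-]; exists (g x); rewrite -lpowSr.
have : lpow g n y \in im_pred (lpow g n) by rewrite inE; exists y.
rewrite -(stat n.+1 (leqnSn n)) inE => -[x]; rewrite lpowSr => e; exists x.
have ninj m z : lpow g m z = 0 -> z = 0 by elim: m => //= m IH /ginj.
apply/eqP; rewrite -subr_eq0; apply/eqP/(ninj n).
by rewrite linearB e subrr.
Qed.

(** Otherwise f x = r *: g x for some r, and the elements x_n = r^n *: x satisfy
    f x_n = g x_(n+1).  The descending chain of the submodules generated by the
    g x_n is stationary, so g x_n is a multiple of g x_(n+1) for some n.  Such a
    relation descends to n - 1: it says that f kills x_(n-1) - a *: x_n, and
    then so does g. *)
Lemma kernel_le_image f g x :
  (forall y, f y = 0 -> g y = 0) -> exists a : R^c, g x = a *: f x.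
Proof.
move=> kfg; have [//|[r fgr]] := uniserial_elt (f x) (g x).
have [xs [xs0 xsS]] : exists xs : nat -> U,
    xs 0%N = x /\ forall n, xs n.+1 = r *: xs n.
  by exists (fun n => iter n ( *:%R r) x).
have fg n : f (xs n) = g (xs n.+1).
  by elim: n => [|n IH]; rewrite xsS linearZ ?xs0 //= IH -linearZ -xsS.
have [n|n z|n stat] := artU (N := fun n => cyc_pred (g (xs n))).
- exact: cyc_pred_closed.
- by rewrite !inE => -[a ->]; exists (a * r); rewrite xsS linearZ scalerA.
have [a] : exists a : R^c, g (xs n) = a *: g (xs n.+1).
  have : g (xs n) \in cyc_pred (g (xs n)).
    by rewrite inE; exists 1; rewrite scale1r.
  by rewrite -(stat n.+1 (leqnSn n)) inE.
(* For n = 0 the relation is the conclusion, because g (xs 1) = f x. *)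
elim: n {stat} => [|n IH] e; first by exists a; rewrite -xs0 fg.
apply: IH; have := kfg (xs n - a *: xs n.+1).
rewrite !linearB !linearZ /= !fg !scalerN -e subrr => /(_ erefl)/eqP.
by rewrite subr_eq0 => /eqP.
Qed.

(** Let W be the stable image f^n U.  Each y is congruent to an element of W
    modulo ker f^n, and W contains ker f^n: otherwise W would be contained in
    ker f^n and f^(2n) would kill u0. *)
Lemma nonnilpotent_surjective f u0 :
  (forall n, lpow f n u0 <> 0) -> forall y, exists x, f x = y.
Proof.
move=> u0n y.
have [n|n z|n stat] := artU (N := fun n => im_pred (lpow f n)).
- exact: im_pred_closed.
- by rewrite !inE => -[x <-]; exists (f x); rewrite -lpowSr.
suff : y \in im_pred (lpow f n).
  rewrite -(stat n.+1) ?leqnSn // inE => -[x <-]; by exists (lpow f n x).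
have [z e] : exists z, lpow f n (lpow f n z) = lpow f n y.
  have : lpow f n y \in im_pred (lpow f n) by rewrite inE; exists y.
  rewrite -(stat (n + n)%N) ?leq_addr // inE => -[z]; rewrite lpowD.
  by exists z.
have ker0 : lpow f n (y - lpow f n z) = 0 by rewrite linearB e subrr.
have : y - lpow f n z \in im_pred (lpow f n).
  have [[r ->]|[r u0r]] := uniserial_elt (lpow f n u0) (y - lpow f n z).
    by rewrite inE; exists (r *: u0); rewrite linearZ.
  case: (u0n (n + n)%N); rewrite lpowD u0r linearZ; move: ker0 => /= ->.
  by rewrite scaler0.
rewrite !inE => -[z' e']; exists (z' + z).
by rewrite linearD e' subrK.
Qed.

Lemma lpow_surjective f : (forall y, exists x, f x = y) ->
  forall n y, exists x, lpow f n x = y.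
Proof.
move=> fsurj; elim=> [|n IH] y; first by exists y.
by have [z <-] := fsurj y; have [x <-] := IH z; exists x.
Qed.

Variable s : U.
Hypothesis socP : forall x, x <> 0 -> exists r : R^c, r *: x = s.

Lemma noninjective_kills_socle (V : rmodType R) (g : {linear U -> V}) x :
  x <> 0 -> g x = 0 -> g s = 0.
Proof. by move=> /socP[r <-] gx; rewrite linearZ /= gx scaler0. Qed.

Lemma socle_nonkilled_bijective g : g s <> 0 -> bijective g.
Proof.
move=> gs; apply: injective_endo_bijective => x gx.
by apply: contrapT => /noninjective_kills_socle/(_ gx).
Qed.

(** A minimal kernel is least, because the submodules of U form a chain. *)
Lemma least_kernel :
  exists f, f s = 0 /\ forall g, g s = 0 -> forall x, f x = 0 -> g x = 0.
Proof.
pose F (t : {g : {linear U -> U} | g s = 0}) := ker_pred (sval t).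
have [t||[f fs] fmin] := @artinian_minimal _ F artU.
- exact: ker_pred_closed.
- by exists [the {linear U -> U} of \0].
exists f; split=> // g gs x.
have [fg|gf] := uniU (ker_pred_closed f) (ker_pred_closed g).
  by move=> fx; apply/eqP; have := fg x; rewrite !inE; apply; apply/eqP.
have /(_ x) := fmin (exist _ g gs) gf; rewrite !inE => h fx.
by apply/eqP/h/eqP.
Qed.

End Uniserial.

(** * Endomorphisms of direct sums that are the identity modulo the radical *)

Section LocallyNilpotent.
Variables (R : pzRingType) (U : rmodType R).
Hypotheses (artU : artinian U) (uniU : uniserial U).
Variables (s : U) (f : {linear U -> U}).
Hypothesis fmin :
  forall g : {linear U -> U}, g s = 0 -> forall x, f x = 0 -> g x = 0.
Hypothesis fnil : forall u, exists n, lpow f n u = 0.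
Variable X : Type.

(** e maps the elements with all coordinates in ker f^(n+1) to elements with all
    coordinates in ker f^n, by [kernel_le_image] applied to the matrix entries
    of e, which kill s. *)
Lemma radical_locally_nilpotent (e : {linear dsum X U -> dsum X U}) :
  (forall x, e (din x s) = 0) -> forall a, exists n, iter n e a = 0.
Proof.
move=> es a.
have [n an] : exists n, forall x, lpow f n (a x) = 0.
  elim/dsum_ind: a => [|a b [m am] [n bn]|x u].
  - by exists 0%N.
  - exists (m + n)%N => x; rewrite dsumD linearD /= {1}addnC !lpowD.
    by rewrite am bn !linear0 addr0.
  - have [n un] := fnil u; exists n => y.
    have [->|yx] := pselect (y = x); first by rewrite dinE.
    by rewrite dinN // linear0.
exists n; elim: n a an => [|n IH] a an; first exact: dsum_ext.
rewrite iterSr; apply: IH.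
apply: (dsum_ind_supp (a := a) (P := fun b => forall z, lpow f n (e b z) = 0)).
- by move=> z; rewrite linear0 dsum0 linear0.
- by move=> b c eb ec z; rewrite linearD dsumD linearD /= eb ec addr0.
move=> x z; pose g := [the {linear U -> U} of dcoord z \o (e \o din x)].
have gs : g s = 0 by rewrite /= es.
have [r gE] := kernel_le_image artU uniU (a x) (fmin gs).
by rewrite -[e _ z]/(g (a x)) gE linearZ /= -lpowSr an scaler0.
Qed.

(** The inverse of h is the geometric series in 1 - h, which is finite at each
    element. *)
Lemma bijective_of_radical (h : {linear dsum X U -> dsum X U}) :
  (forall x, h (din x s) = din x s) -> bijective h.
Proof.
move=> hs; pose e := [the {linear dsum X U -> dsum X U} of idfun \- h].
have enil := @radical_locally_nilpotent e.
have {enil}enil a : exists n, iter n e a = 0.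
  by apply: enil => x; rewrite /= hs subrr.
apply: bijective_of => [a ha|b].
  have [n] := enil a; suff -> : iter n e a = a by [].
  by elim: n => [|n IH] //=; rewrite IH /= ha subr0.
have [n] := enil b; elim: n b => [|n IH] b.
  by move=> /= ->; exists 0; rewrite linear0.
rewrite iterSr => /IH[a ha]; exists (b + a).
by rewrite linearD /= ha /= addrC subrK.
Qed.

End LocallyNilpotent.

(** * Independent sets of homomorphisms *)

Section Independence.
Variables (R : pzRingType) (U B : lmodType R).
Local Notation hom := {linear U -> B}.
Implicit Types (S I P : set hom) (c d : dsum hom U).

Definition supported c S := forall t, c t <> 0 -> S t.

Definition combine c : B := dlift (fun t => t) c.
Fact combine_is_linear : linear combine.
Proof. exact: linearP. Qed.
HB.instance Definition _ :=
  GRing.isLinear.Build R (dsum hom U) B *:%R combine combine_is_linear.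

(** S is independent when the map from the direct sum of copies of U indexed by
    S to B is injective.  Indexing by all homomorphisms lets S vary without
    changing the type of c. *)
Definition independent S := forall c, supported c S -> combine c = 0 -> c = 0.

Lemma combine_in (t : hom) u : combine (din t u) = t u.
Proof. exact: dlift_in. Qed.

Lemma supportedD c d S : supported c S -> supported d S -> supported (c + d) S.
Proof.
move=> cS dS t; rewrite dsumD => cdt.
have [ct|/cS//] := pselect (c t = 0).
by apply: dS => dt; apply: cdt; rewrite ct dt addr0.
Qed.

Lemma supportedZ (r : R) c S : supported c S -> supported (r *: c) S.
Proof.
move=> cS t; rewrite dsumZ => rct; apply: cS => ct.
by rewrite ct scaler0 in rct.
Qed.

Lemma supported_in (t : hom) u S : S t -> supported (din t u) S.
Proof. by move=> St t'; have [->//|ne] := pselect (t' = t); rewrite dinN. Qed.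

Lemma supported_sub c S S' : S `<=` S' -> supported c S -> supported c S'.
Proof. by move=> sub cS t /cS/sub. Qed.

Lemma supported_ind c S (Q : dsum hom U -> Prop) : supported c S ->
  Q 0 -> (forall b d, Q b -> Q d -> Q (b + d)) ->
  (forall t, S t -> Q (din t (c t))) -> Q c.
Proof.
move=> cS Q0 QD Qin; apply: dsum_ind_supp => // t.
by have [->|/cS/Qin//] := pselect (c t = 0); rewrite linear0.
Qed.

(** Zorn's lemma: a dependence relation has finite support, so it is already
    one in a member of the chain. *)
Lemma independent_maximal I P : independent I ->
  exists S, [/\ I `<=` S, S `<=` I `|` P, independent S &
    forall t, P t -> independent (t |` S) -> S t].
Proof.
move=> indI; pose good X := X `<=` P /\ independent (I `|` X).
have [|X [[XP indX] Xmax]] := @Zorn_bigcup _ good.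
  move=> F Fgood Ftot; split; first by move=> t [X /Fgood[XP _]] /XP.
  move=> c csup ec; have [[X0 FX0]|noF] := pselect (exists X, F X); last first.
    apply: (indI c _ ec); apply: (supported_sub _ csup) => t [//|[X FX]].
    by case: noF; exists X.
  have [X [FX cX]] : exists X, F X /\ supported c (I `|` X).
    pose Q b := exists X, F X /\ supported b (I `|` X).
    apply: (supported_ind (Q := Q) csup) => [|b d [X [FX bX]] [Y [FY dY]]|t].
    - by exists X0; split=> // t; rewrite dsum0.
    - have [XY|YX] := Ftot _ _ FX FY; [exists Y|exists X]; split=> //;
        apply: supportedD => //;
        [apply: supported_sub bX|apply: supported_sub dY]; exact: setUS.
    - by case=> [It|[X FX Xt]]; [exists X0|exists X]; split=> //;
         apply: supported_in; [left|right].
  by have [_ indX] := Fgood _ FX; apply: indX.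
exists (I `|` X); split; [exact: subsetUl|exact: setUS|by []|].
move=> t Pt indt; apply: contrapT => /not_orP[nIt nXt].
apply: (Xmax (t |` X)); last first.
  split; first by move=> t' [->|/XP].
  by rewrite setUCA.
split=> [t' Xt'|/(_ t) tX]; first by right.
by apply: nXt; apply: tX; left.
Qed.

Lemma independent_relation S (t : hom) :
  independent S -> ~ independent (t |` S) ->
  exists u c, [/\ u <> 0, supported c S & t u = combine c].
Proof.
move=> indS nind.
have [c [cS ec cn]] : exists c,
    [/\ supported c (t |` S), combine c = 0 & c <> 0].
  apply: contrapT => no; apply: nind => c cS ec; apply: contrapT => cn.
  by apply: no; exists c.
pose d := c - din t (c t).
have dS : supported d S.
  move=> t'; rewrite dsumB; have [->|ne] := pselect (t' = t).
    by rewrite dinE subrr.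
  by rewrite dinN // subr0 => /cS[].
exists (c t), (- d); split.
- move=> ct; apply: cn; apply: indS => //.
  by move: dS; rewrite /d ct linear0 subr0.
- by rewrite -scaleN1r; exact: supportedZ.
- by rewrite linearN /= linearB /= combine_in ec sub0r opprK.
Qed.

End Independence.

(** * Exchange *)

Section Elimination.
Variables (R : pzRingType) (U : rmodType R) (Y : Type).
Hypothesis artU : artinian U.
Variable s : U.
Hypothesis socP : forall x, x <> 0 -> exists r : R^c, r *: x = s.
Local Notation B := (dsum Y U).
Variable G : B -> Prop.
Hypotheses (G0 : G 0) (GD : forall a b, G a -> G b -> G (a + b)).

Definition maps_in (t : {linear U -> B}) := forall u, G (t u).

(** The coefficients r are scalars; multiplication by r need not be an
    endomorphism of U. *)
Fixpoint soc_comb n (b : B) : Prop :=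
  if n is m.+1 then
    exists t (r : R^c) b', [/\ maps_in t, soc_comb m b' & b = b' + t (r *: s)]
  else b = 0.

Lemma soc_comb_map (p : {linear B -> B}) n b :
  (forall a, G a -> G (p a)) -> soc_comb n b -> soc_comb n (p b).
Proof.
move=> pG; elim: n b => [|n IH] b /=; first by move->; rewrite linear0.
move=> [t [r [b' [tG b'n ->]]]].
exists [the {linear U -> B} of p \o t], r, (p b').
split; last by rewrite linearD.
  by move=> u; exact: pG.
exact: IH.
Qed.

Lemma soc_combD m n a b :
  soc_comb m a -> soc_comb n b -> soc_comb (n + m) (a + b).
Proof.
elim: n b => [|n IH] b /= am; first by move->; rewrite addr0.
move=> [t [r [b' [tG b'n ->]]]]; exists t, r, (a + b'); split=> //.
  exact: IH.
by rewrite addrA.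
Qed.

(** This turns scalar coefficients into endomorphisms of U, by Gaussian
    elimination: some coordinate of a term t is nonzero at s, hence an
    automorphism, and subtracting a multiple of t clears that coordinate in t0
    and in the other terms. *)
Lemma soc_comb_realized n (t0 : {linear U -> B}) :
  soc_comb n (t0 s) -> exists2 w : {linear U -> B}, maps_in w & w s = t0 s.
Proof.
elim: n t0 => [|n IH] t0 /=.
  by move=> ->; exists [the {linear U -> B} of \0].
move=> [t [r [b [tG bn t0s]]]].
have [ts0|ts] := pselect (t s = 0).
  by apply: IH; rewrite t0s linearZ /= ts0 scaler0 addr0.
have [y tsy] : exists y, t s y <> 0.
  apply: contrapT => no; apply: ts; apply: dsum_ext => y.
  by apply: contrapT => tsy; apply: no; exists y.
pose v := [the {linear U -> U} of dcoord y \o t].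
have [v' [vK v'K]] :=
    linear_inv (socle_nonkilled_bijective artU socP (g := v) tsy).
(* p is the projection of B along the image of t, onto the elements whose
   coordinate at y is zero. *)
pose k := [the {linear B -> U} of v' \o dcoord y].
pose p := [the {linear B -> B} of idfun \- (t \o k)].
have pG a : G a -> G (p a).
  by move=> Ga; rewrite /p /= -linearN /=; apply: GD.
have [|w wG ws] := IH [the {linear U -> B} of p \o t0].
  have pt : p (t (r *: s)) = 0.
    have kt u : k (t u) = u by exact: vK.
    by rewrite -[LHS]/(t (r *: s) - t (k (t (r *: s)))) kt subrr.
  rewrite -[X in soc_comb _ X]/(p (t0 s)) t0s linearD [X in _ + X]pt addr0.
  exact: soc_comb_map.
exists [the {linear U -> B} of w \+ (t \o (k \o t0))].
  by move=> u; apply: (GD (wG u) (tG _)).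
by rewrite /= ws /= subrK.
Qed.

End Elimination.

(** * Complements modulo the radical *)

Section Decomposition.
Variables (R : pzRingType) (U : rmodType R).
Hypotheses (artU : artinian U) (uniU : uniserial U).
Variables (s : U) (f : {linear U -> U}).
Hypothesis socP : forall x, x <> 0 -> exists r : R^c, r *: x = s.
Hypothesis soc_neq0 : (exists x : U, x <> 0) -> s <> 0.
Hypothesis fmin :
  forall g : {linear U -> U}, g s = 0 -> forall x, f x = 0 -> g x = 0.
Hypothesis fnil : forall u, exists n, lpow f n u = 0.
Variable Y : Type.
Local Notation B := (dsum Y U).
Local Notation hom := {linear U -> B}.
Local Notation inj y := [the hom of din y].

(** Let G be the span of S.  Maximality gives for each y a relation between the
    y-th inclusion of U and elements of S, and [soc_comb_realized] turns its
    multiple at s into a map w y : U -> G that agrees with the y-th inclusion at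
    s.  The endomorphism of U^(Y) with components w y has its image in G, and it
    is bijective by [bijective_of_radical]. *)
Lemma maximal_independent_spans (S : set hom) : independent S ->
  (forall y, independent (inj y |` S) -> S (inj y)) ->
  forall b, exists2 c, supported c S & combine c = b.
Proof.
move=> indS maxS.
pose G b := exists2 c, supported c S & combine c = b.
have G0 : G 0 by exists 0; [move=> t; rewrite dsum0|rewrite linear0].
have GD a b : G a -> G b -> G (a + b).
  move=> [c cS <-] [d dS <-]; exists (c + d); last by rewrite linearD.
  exact: supportedD.
have SG t u : S t -> G (t u).
  by move=> St; exists (din t u); [exact: supported_in|exact: combine_in].
have wP y : exists2 w : hom, maps_in G w & w s = din y s.
  have [Sy|nSy] := pselect (S (inj y)).
    by exists (inj y) => // u; exact: SG.
  have [u [c [un cS yu]]] :=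
    independent_relation indS (fun ind => nSy (maxS y ind)).
  have [r ru] := socP un.
  have [c' c'S ec'] : exists2 c', supported c' S & combine c' = din y s.
    exists (r *: c); first exact: supportedZ.
    by rewrite linearZ /= -yu /= -linearZ ru.
  (* The map r *: s |-> r *: c' is well defined, because combine is injective on
     combinations supported in S; so each nonzero c' t generates a simple
     submodule, which is the one generated by s. *)
  have c'soc t : exists a : R^c, c' t = a *: s.
    have [->|c't] := pselect (c' t = 0); first by exists 0; rewrite scale0r.
    have [r1 r1c] := socP c't.
    have r1s : r1 *: s <> 0.
      move=> r1s; have : r1 *: c' = 0.
        apply: indS; first exact: supportedZ.
        by rewrite linearZ /= ec' -linearZ r1s linear0.
      move/(congr1 (fun d : dsum hom U => d t)); rewrite dsumZ dsum0 r1c.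
      by apply: soc_neq0; exists u.
    have [r2 r2s] := socP r1s; exists r2; rewrite -r1c.
    apply/eqP; rewrite -subr_eq0; apply/eqP.
    have : c' - r2 *: (r1 *: c') = 0.
      apply: indS.
        rewrite -scaleN1r; apply: supportedD => //.
        by do 3!apply: supportedZ.
      have e2 : combine (r2 *: (r1 *: c')) = din y s.
        by rewrite !linearZ_LR /= ec' -!linearZ_LR r2s.
      by rewrite linearB /= e2 ec' subrr.
    by move/(congr1 (fun d : dsum hom U => d t)); rewrite dsumB !dsumZ dsum0.
  have [n ysn] : exists n, soc_comb s G n (din y s).
    rewrite -ec'.
    apply: (supported_ind (c := c')
      (Q := fun c => exists n, soc_comb s G n (combine c)) c'S).
    - by exists 0%N; rewrite linear0.
    - move=> b d [m bm] [n dn]; exists (n + m)%N; rewrite linearD.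
      exact: soc_combD.
    - move=> t St; have [a ->] := c'soc t; exists 1%N, t, a, 0.
      by rewrite combine_in add0r; split=> // v; exact: SG.
  exact: (soc_comb_realized artU socP G0 GD (t0 := inj y) ysn).
have /choice[w wP'] y : exists w : hom, maps_in G w /\ w s = din y s.
  by have [w wG ws] := wP y; exists w.
have [|g _ gK] := @bijective_of_radical _ _ artU uniU s f fmin fnil _
    [the {linear B -> B} of dlift w].
  by move=> y; rewrite /= dlift_in (wP' y).2.
move=> b; rewrite -(gK b); elim/dsum_ind: (g b) => [|a a' Ga Ga'|y u].
- by rewrite linear0.
- by rewrite linearD; exact: GD.
- by rewrite /= dlift_in; exact: (wP' y).1.
Qed.

(** Take I maximal independent among the maps into K, and S maximal independent
    among the sets that consist of I and of inclusions of copies of U.  Then S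
    is a basis, and X is the complement of I in S.  A map t with j t in K that
    did not kill s would be injective and independent of I, against the
    maximality of I. *)
Lemma radical_complement (K : B -> Prop) :
  K 0 -> (forall a b, K a -> K b -> K (a + b)) ->
  exists (X : Type) (j : {linear dsum X U -> B}) (q : {linear B -> dsum X U}),
    [/\ cancel j q, forall b, K (b - j (q b)) &
        forall t : {linear U -> dsum X U}, (forall u, K (j (t u))) -> t s = 0].
Proof.
move=> K0 KD; pose inK := [set t : hom | forall u, K (t u)].
have ind0 : independent (set0 : set hom).
  move=> c c0 _; apply: dsum_ext => t; apply: contrapT => ct.
  exact: (c0 t ct).
have [I [_ IK indI maxI]] := independent_maximal inK ind0.
have [S [IS _ indS maxS]] := independent_maximal [set inj y | y in setT] indI.
have genS := maximal_independent_spans indS (fun y =>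
  maxS _ (ex_intro2 _ _ y Logic.I erefl)).
have /choice[dec decP] b : exists c, supported c S /\ combine c = b.
  by have [c] := genS b; exists c.
have decE b c : supported c S -> combine c = b -> dec b = c.
  move=> cS cb; have [dS db] := decP b.
  apply/eqP; rewrite -subr_eq0; apply/eqP/indS.
    by rewrite -scaleN1r; apply: supportedD => //; exact: supportedZ.
  by rewrite linearB /= db cb subrr.
have [|ldec ldecE] := @linear_of _ _ _ dec.
  move=> r a b; have [aS ea] := decP a; have [bS eb] := decP b.
  apply: decE; last by rewrite linearP /= ea eb.
  by apply: supportedD => //; exact: supportedZ.
pose X := {t : hom | S t /\ ~ I t}.
have [rest restI restX] : exists2 rest : {linear dsum hom U -> dsum X U},
    forall t u, I t -> rest (din t u) = 0 &
    forall (x : X) u, rest (din (sval x) u) = din x u.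
  exists [the {linear _ -> _} of dlift (fun t : hom =>
    if pselect (S t /\ ~ I t) is left p
    then [the {linear U -> dsum X U} of din (exist _ t p)]
    else [the {linear U -> dsum X U} of \0])] => [t u It|x u].
  - by rewrite /= dlift_in; case: pselect => // -[].
  - rewrite /= dlift_in; case: pselect => [p|[]]; last exact: (svalP x).
    congr (din _ u); case: x p => t p p'; congr exist.
    exact: Prop_irrelevance.
have [ext extX] : exists ext : {linear dsum X U -> dsum hom U},
    forall x u, ext (din x u) = din (sval x) u.
  exists [the {linear _ -> _} of dlift (fun x : X =>
    [the {linear U -> dsum hom U} of din (sval x)])] => x u.
  by rewrite /= dlift_in.
have extK : cancel ext rest.
  apply: (@dsum_eq _ _ _ _ [the {linear _ -> _} of rest \o ext] idfun) => x u.
  by rewrite /= extX restX.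
have extS z : supported (ext z) S.
  elim/dsum_ind: z => [|a b aS bS|x u].
  - by move=> t; rewrite linear0 dsum0.
  - by rewrite linearD; exact: supportedD.
  - by rewrite extX; apply: supported_in; case: x => ? [].
exists X, [the {linear dsum X U -> B} of @combine _ U B \o ext].
exists [the {linear B -> dsum X U} of rest \o ldec].
have jq z : ldec (combine (ext z)) = ext z by rewrite ldecE; exact: decE.
split.
- by move=> z; rewrite /= jq extK.
- move=> b; have [dS db] := decP b.
  rewrite /= ldecE -{1}db -linearB.
  apply: (supported_ind (Q := fun c => K (combine (c - ext (rest c)))) dS).
  + by rewrite !(linear0, addr0).
  + move=> c d Kc Kd; have -> : c + d - ext (rest (c + d)) =
        (c - ext (rest c)) + (d - ext (rest d)) by rewrite !linearD /= addrACA.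
    by rewrite linearD; exact: KD.
  + move=> t St; have [It|nIt] := pselect (I t).
      rewrite restI // linear0 subr0 combine_in.
      by have [//|] := IK _ It; apply.
    pose x : X := exist _ t (conj St nIt).
    by rewrite (restX x) extX /= subrr linear0.
- move=> t tK; pose w := [the hom of @combine _ U B \o (ext \o t)].
  have wE u c : supported c S -> w u = combine c -> t u = rest c.
    move=> cS e; rewrite -(extK (t u)); congr (rest _).
    by rewrite -jq ldecE; apply: decE => //; rewrite -e.
  have [Iw|nIw] := pselect (I w).
    rewrite (wE s (din w s)) ?restI ?combine_in //.
    by apply: supported_in; exact: IS.
  have [u [c [un cI wu]]] :=
    independent_relation indI (fun ind => nIw (maxI w tK ind)).
  apply: (noninjective_kills_socle socP un).
  rewrite (wE u c) //; last exact: supported_sub cI.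
  apply: (supported_ind (Q := fun c => rest c = 0) cI).
  + by rewrite linear0.
  + by move=> a b ea eb; rewrite linearD /= ea eb addr0.
  + by move=> t' It'; rewrite restI.
Qed.

End Decomposition.

(** * The class Add(U) *)

Section AddClass.
Variables (R : pzRingType) (U : rmodType R).

Lemma iso_dsum_Add (M : rmodType R) (X : Type) (g : {linear M -> dsum X U}) :
  bijective g -> Add U M.
Proof.
move=> [g' gK g'K]; exists X, (dsum void U : rmodType R).
exists [the {linear _ -> _} of g \o fst].
exists (fun a => (g' a, 0)) => [[m n]|a] /=; last exact: g'K.
by rewrite gK; congr (_, _); apply: dsum_ext => -[].
Qed.

Lemma dsum_Add (X : Type) : Add U (dsum X U : rmodType R).
Proof.
by apply: (@iso_dsum_Add _ X [the {linear _ -> _} of idfun]); exists id.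
Qed.

Lemma self_Add : Add U U.
Proof.
apply: (@iso_dsum_Add _ unit [the {linear _ -> _} of din tt]).
exists (dcoord tt) => [u|a]; first exact: dinE.
by apply: dsum_ext => -[]; rewrite dinE.
Qed.

Lemma Add_retract (M : rmodType R) : Add U M ->
  exists (X : Type) (a : {linear M -> dsum X U}) (r : {linear dsum X U -> M}),
    cancel a r.
Proof.
move=> [X [N [f /linear_inv[g [fK gK]]]]]; exists X.
have [|a aE] := @linear_of _ M (dsum X U) (fun m => f (m, 0)).
  move=> c m m'; rewrite -linearP; congr (f _).
  by apply: injective_projections; rewrite /= ?scaler0 ?addr0.
exists a, [the {linear _ -> _} of fst \o g] => m.
by rewrite /= aE fK.
Qed.

End AddClass.

(** * Covers and direct limits in the locally nilpotent case *)

Section LocallyNilpotentCase.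
Variables (R : pzRingType) (U : rmodType R).
Hypotheses (artU : artinian U) (uniU : uniserial U).
Variables (s : U) (f : {linear U -> U}).
Hypothesis socP : forall x, x <> 0 -> exists r : R^c, r *: x = s.
Hypothesis soc_neq0 : (exists x : U, x <> 0) -> s <> 0.
Hypothesis fmin :
  forall g : {linear U -> U}, g s = 0 -> forall x, f x = 0 -> g x = 0.
Hypothesis fnil : forall u, exists n, lpow f n u = 0.

(** With K the kernel of the canonical map p, an endomorphism h of the
    complement that is compatible with p differs from the identity by a map into
    K, so h is the identity modulo the radical, hence bijective. *)
Lemma nilpotent_covering : covering (Add U).
Proof.
move=> A; pose hom := {linear U -> A}.
have [p pE] : exists p : {linear dsum hom U -> A},
    forall t u, p (din t u) = t u.
  exists [the {linear _ -> _} of dlift (fun t : hom => t)] => t u.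
  exact: dlift_in.
have [||X [j [q [qj jqK rad]]]] :=
  radical_complement artU uniU socP soc_neq0 fmin fnil (K := fun b => p b = 0).
- by rewrite linear0.
- by move=> a b pa pb; rewrite linearD pa pb addr0.
have pjq b : p (j (q b)) = p b.
  by apply/esym/eqP; rewrite -subr_eq0 -linearB; apply/eqP/jqK.
exists (dsum X U : rmodType R), [the {linear _ -> _} of p \o j].
split; first split; first exact: dsum_Add.
  move=> B' g /Add_retract[Z [a [r ra]]].
  pose l : {linear dsum Z U -> dsum hom U} := [the {linear _ -> _} of dlift
    (fun z => [the {linear U -> _} of
                din [the {linear U -> A} of g \o (r \o din z)]])].
  have pl z : p (l z) = g (r z).
    apply: (@dsum_eq _ _ _ _ [the {linear _ -> _} of p \o l]
              [the {linear _ -> _} of g \o r]).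
    by move=> x u; rewrite /= dlift_in pE.
  exists [the {linear _ -> _} of q \o (l \o a)] => b.
  by rewrite -[LHS]/(p (j (q (l (a b))))) pjq pl ra.
move=> h ch; apply: (bijective_of_radical artU uniU fmin fnil) => x.
pose t := [the {linear U -> dsum X U} of din x \- (h \o din x)].
suff : t s = 0 by move/eqP; rewrite subr_eq0 => /eqP.
apply: rad => u; rewrite /= !linearB /=.
by have /= -> := ch (din x u); rewrite subrr.
Qed.


(** If j z = n is in K, an endomorphism e fixing n with values in K induces an
    endomorphism q e j of U^(X) that fixes z; its components are maps from U
    into K, hence kill s, so it is locally nilpotent and z = 0.  So K meets the
    complement trivially and the projection q kills all of K. *)
Lemma locally_split_complement (Y : Type) (K : dsum Y U -> Prop) :
  K 0 -> (forall a b, K a -> K b -> K (a + b)) -> (forall a, K a -> K (- a)) ->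
  (forall n, K n -> exists e : {linear dsum Y U -> dsum Y U},
     e n = n /\ forall b, K (e b)) ->
  exists (X : Type) (j : {linear dsum X U -> dsum Y U})
         (q : {linear dsum Y U -> dsum X U}),
    [/\ cancel j q, forall b, K (b - j (q b)) & forall b, K b -> q b = 0].
Proof.
move=> K0 KD KN split.
have [X [j [q [qj jqK rad]]]] :=
  radical_complement artU uniU socP soc_neq0 fmin fnil K0 KD.
exists X, j, q; split=> // n Kn.
have Kjq b : K b -> K (j (q b)).
  move=> Kb; rewrite -[j _](subKr b); apply: KD => //.
  by apply: KN; exact: jqK.
have [e [ez eK]] := split _ (Kjq _ Kn).
pose h := [the {linear dsum X U -> dsum X U} of q \o (e \o j)].
have hs x : h (din x s) = 0.
  apply: (rad [the {linear U -> dsum X U} of h \o din x]) => u.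
  by apply: Kjq; exact: eK.
have hz : h (q n) = q n by rewrite /= ez qj.
have [m] := radical_locally_nilpotent artU uniU fmin fnil hs (q n).
by rewrite iter_fix.
Qed.

(** Write each M i as a retract of some U^(X i), and L as the image of
    B = U^(Y), Y the disjoint union of the X i.  For a bound k of the support of
    b, moving all components of b to index k gives Phi k b in M k; the relations
    are the b with Phi k b = 0 for some such k.  To see that the relations are
    locally split, fix a relation with support bounded by k, and replace each
    component with index at most k by its difference with its image at index
    k, dropping the other components. *)
Lemma nilpotent_closed : closed_under_direct_limits (Add U).
Proof.
move=> d I M phi [[i0] dirI phi_id phi_comp] AddM L g [gco guniv].
pose R0 i := cid (Add_retract (AddM i)).
pose X i := sval (R0 i).
pose R1 i := cid (svalP (R0 i)).
pose a i : {linear M i -> dsum (X i) U} := sval (R1 i).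
pose R2 i := cid (svalP (R1 i)).
pose r i : {linear dsum (X i) U -> M i} := sval (R2 i).
have ra i : cancel (a i) (r i) by exact: (svalP (R2 i)).
clearbody r; clear R2; clearbody a; clear R1; clearbody X; clear R0.
pose Y := {i : I & X i}.
pose B := (dsum Y U : rmodType R).
have [inc incE] : exists inc : forall i, {linear dsum (X i) U -> B},
    forall i x u, inc i (din x u) = din (existT X i x) u.
  exists (fun i => [the {linear _ -> _} of
    dlift (fun x => [the {linear U -> B} of din (existT X i x)])]) => i x u.
  exact: dlift_in.
have [Phi Phi_in Phi_out] : exists2 Phi : forall k, {linear B -> M k},
    forall i k (ik : (i <= k)%O) x u,
      Phi k (din (existT X i x) u) = phi i k ik (r i (din x u)) &
    forall k y u, ~ (tag y <= k)%O -> Phi k (din y u) = 0.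
  exists (fun k => [the {linear _ -> _} of dlift (fun y : Y =>
    if pselect (tag y <= k)%O is left le
    then [the {linear U -> M k} of phi _ _ le \o (r (tag y) \o din (tagged y))]
    else [the {linear U -> M k} of \0])]).
  - move=> i k ik x u; rewrite /= dlift_in; case: pselect => [le|//].
    by rewrite (Prop_irrelevance le ik).
  - by move=> k y u nle; rewrite /= dlift_in; case: pselect.
have [p pE] : exists p : {linear B -> L},
    forall i x u, p (din (existT X i x) u) = g i (r i (din x u)).
  exists [the {linear _ -> _} of dlift (fun y : Y =>
    [the {linear U -> L} of g (tag y) \o (r (tag y) \o din (tagged y))])].
  by move=> i x u; rewrite /= dlift_in.
pose below k (b : B) := forall y, b y <> 0 -> (tag y <= k)%O.
have below_ind k b (Q : B -> Prop) : below k b ->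
    Q 0 -> (forall b c, Q b -> Q c -> Q (b + c)) ->
    (forall i x u, (i <= k)%O -> Q (din (existT X i x) u)) -> Q b.
  move=> bk Q0 QD Qin; apply: dsum_ind_supp => // -[i x].
  have [->|/bk] := pselect (b (existT X i x) = 0); first by rewrite linear0.
  exact: Qin.
have below_le k k' b : (k <= k')%O -> below k b -> below k' b.
  by move=> kk' bk y /bk yk; exact: le_trans kk'.
have belowD k b c : below k b -> below k c -> below k (b + c).
  move=> bk ck y; rewrite dsumD => bcy.
  have [b0|/bk//] := pselect (b y = 0).
  by apply: ck => c0; apply: bcy; rewrite b0 c0 addr0.
have belowN k b : below k b -> below k (- b).
  move=> bk y nb; apply: bk => b0; apply: nb.
  by rewrite -[LHS]/(- b y) b0 oppr0.
have below_inc i k z : (i <= k)%O -> below k (inc i z).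
  move=> ik; elim/dsum_ind: z => [|b c bk ck|x u] /=.
  - by rewrite linear0 => y; rewrite dsum0.
  - by rewrite linearD; exact: belowD.
  - rewrite incE => y; have [->//|ne] := pselect (y = existT X i x).
    by rewrite dinN.
have Phi_inc i k (ik : (i <= k)%O) z : Phi k (inc i z) = phi i k ik (r i z).
  apply: (@dsum_eq _ _ _ _ [the {linear _ -> _} of Phi k \o inc i]
            [the {linear _ -> _} of phi i k ik \o r i]) => x u.
  by rewrite /= incE (Phi_in _ _ ik).
have p_inc i z : p (inc i z) = g i (r i z).
  apply: (@dsum_eq _ _ _ _ [the {linear _ -> _} of p \o inc i]
            [the {linear _ -> _} of g i \o r i]) => x u.
  by rewrite /= incE pE.
have Phi_le k k' (kk' : (k <= k')%O) b : below k b ->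
    Phi k' b = phi k k' kk' (Phi k b).
  pose Q b := Phi k' b = phi k k' kk' (Phi k b).
  move=> bk; apply: (below_ind k b Q bk); rewrite /Q.
  - by rewrite !linear0.
  - by move=> b1 b2 e1 e2; rewrite !linearD e1 e2.
  - move=> i x u ik; rewrite (Phi_in _ _ ik) (Phi_in _ _ (le_trans ik kk')).
    by rewrite -(phi_comp _ _ _ ik kk').
have p_Phi k b : below k b -> p b = g k (Phi k b).
  move=> bk; apply: (below_ind k b (fun b => p b = g k (Phi k b)) bk).
  - by rewrite !linear0.
  - by move=> b1 b2 e1 e2; rewrite !linearD e1 e2.
  - by move=> i x u ik; rewrite (Phi_in _ _ ik) pE -(gco _ _ ik).
pose K b := exists k, below k b /\ Phi k b = 0.
have K0 : K 0 by exists i0; rewrite linear0; split=> // y; rewrite dsum0.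
have KD b c : K b -> K c -> K (b + c).
  move=> [k [bk b0]] [k' [ck' c0]]; have [m [km k'm]] := dirI k k'.
  have bm := below_le _ _ _ km bk; have cm := below_le _ _ _ k'm ck'.
  exists m; split; first exact: belowD.
  rewrite linearD (Phi_le _ _ km) // (Phi_le _ _ k'm) // b0 c0 !linear0.
  exact: addr0.
have KN b : K b -> K (- b).
  move=> [k [bk b0]]; exists k; rewrite linearN /= b0 oppr0.
  by split=> //; exact: belowN.
have pK b : K b -> p b = 0.
  by move=> [k [bk b0]]; rewrite (p_Phi k) // b0 linear0.
have K_rel i k (ik : (i <= k)%O) z :
    K (inc i z - inc k (a k (phi i k ik (r i z)))).
  exists k; split.
    by apply: belowD; [exact: below_inc|apply/belowN/below_inc].
  rewrite linearB /= (Phi_inc _ _ ik) (Phi_inc _ _ (le_refl k)) ra.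
  by rewrite phi_id subrr.
have split n : K n -> exists e : {linear B -> B}, e n = n /\ forall b, K (e b).
  move=> [k [nk n0]].
  pose cut : {linear B -> B} := [the {linear _ -> _} of dlift (fun y : Y =>
    if pselect (tag y <= k)%O is left le
    then [the {linear U -> B} of din y] else [the {linear U -> B} of \0])].
  have cut_in y u : (tag y <= k)%O -> cut (din y u) = din y u.
    by move=> le; rewrite /= dlift_in; case: pselect.
  have cut_out y u : ~ (tag y <= k)%O -> cut (din y u) = 0.
    by move=> le; rewrite /= dlift_in; case: pselect.
  exists [the {linear B -> B} of cut \- (inc k \o (a k \o Phi k))].
  split=> [|b].
    rewrite -[LHS]/(cut n - inc k (a k (Phi k n))) n0 !linear0 addr0.
    apply: (below_ind k n (fun n => cut n = n) nk).
    - by rewrite linear0.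
    - by move=> b1 b2 e1 e2; rewrite linearD e1 e2.
    - by move=> i x u ik; exact: cut_in.
  rewrite -[X in K X]/(cut b - inc k (a k (Phi k b))).
  elim/dsum_ind: b => [|b c Kb Kc|[i x] u].
  - by rewrite !linear0 addr0.
  - have -> : cut (b + c) - inc k (a k (Phi k (b + c))) =
      (cut b - inc k (a k (Phi k b))) + (cut c - inc k (a k (Phi k c))).
      by rewrite !linearD addrACA.
    exact: KD.
  - have [ik|nik] := pselect (i <= k)%O.
      by rewrite cut_in // (Phi_in _ _ ik) -incE; exact: K_rel.
    by rewrite cut_out // Phi_out // !linear0 addr0.
(* U^(Z) satisfies the universal property of L. *)
have [Z [j [q [qj jqK qK]]]] := locally_split_complement K0 KD KN split.
pose g' i := [the {linear M i -> dsum Z U} of q \o (inc i \o a i)].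
have [|h [hg _]] := guniv (dsum Z U : rmodType R) g'.
  move=> i k ik m /=; apply/esym/eqP; rewrite -subr_eq0 -linearB; apply/eqP/qK.
  by have := K_rel i k ik (a i m); rewrite ra.
have hp b : h (p b) = q b.
  apply: (@dsum_eq _ _ _ _ [the {linear _ -> _} of h \o p] q) => -[i x] u /=.
  rewrite pE; have /= -> := hg i (r i (din x u)).
  apply/esym/eqP; rewrite -subr_eq0 -linearB -incE; apply/eqP/qK.
  by have := K_rel i i (le_refl i) (din x u); rewrite phi_id.
apply: (@iso_dsum_Add _ _ _ Z h).
exists (p \o j) => [l|z] /=; last by rewrite hp qj.
have [h1 [h1g h1u]] := guniv L g gco.
have e1 : p \o (j \o h) =1 h1.
  apply: (h1u [the {linear L -> L} of p \o (j \o h)]) => i m /=.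
  have /= -> := hg i m.
  have : p (inc i (a i m) - j (q (inc i (a i m)))) = 0 by apply: pK; exact: jqK.
  rewrite linearB /= => /eqP; rewrite subr_eq0 => /eqP <-.
  by rewrite p_inc ra.
have e2 : idfun =1 h1 by apply: (h1u [the {linear L -> L} of idfun]).
by have /= -> := e1 l; rewrite -e2.
Qed.
End LocallyNilpotentCase.

(** * Quotient modules *)

Section Quotient.
Variables (R : pzRingType) (M : lmodType R) (N : set M).

Definition submodule := N 0 /\ forall (r : R) x y, N x -> N y -> N (r *: x + y).

Hypothesis subN : submodule.

(** A representative of the class of x that depends on the class only; the
    elements of the quotient are the chosen representatives. *)
Definition qrep x := xget 0 [set y | N (y - x)].
Definition quot of submodule := {x : M | qrep x == x}.
Local Notation Q := (quot subN).
HB.instance Definition _ := Choice.on Q.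

Lemma quot_subB x y : N x -> N y -> N (x - y).
Proof. by move=> Nx Ny; rewrite addrC -scaleN1r; apply: subN.2. Qed.

Lemma quot_subD x y : N x -> N y -> N (x + y).
Proof. by move=> Nx Ny; rewrite -[x]scale1r; apply: subN.2. Qed.

Lemma qrepP x : N (qrep x - x).
Proof.
apply: (@xgetPex _ 0 [set y | N (y - x)]).
by exists x; rewrite /= subrr; exact: subN.1.
Qed.

Lemma qrep_eq x y : (qrep x = qrep y) <-> N (x - y).
Proof.
split=> [e|Nxy].
  have -> : x - y = (qrep y - y) - (qrep x - x).
    by rewrite e opprB [RHS]addrC subrKA.
  by apply: quot_subB; exact: qrepP.
congr xget; apply/seteqP; split=> z /= Nz.
  by rewrite -(subrKA x); exact: quot_subD.
by rewrite -(subrKA y) -[y - x]opprB; exact: quot_subB.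
Qed.

Fact qrep_idem x : qrep (qrep x) == qrep x.
Proof. by apply/eqP/qrep_eq; exact: qrepP. Qed.

Definition qpi x : Q := exist _ (qrep x) (qrep_idem x).

Lemma qpi_eq x y : qpi x = qpi y <-> N (x - y).
Proof.
rewrite -qrep_eq; split=> [/(congr1 sval)//|e].
exact: val_inj.
Qed.

Lemma qpi_val (a : Q) : qpi (sval a) = a.
Proof. by apply: val_inj => /=; apply/eqP; exact: (svalP a). Qed.

Definition qadd (a b : Q) := qpi (sval a + sval b).
Definition qopp (a : Q) := qpi (- sval a).
Definition qscale (r : R) (a : Q) := qpi (r *: sval a).

Lemma qpiD x y : qadd (qpi x) (qpi y) = qpi (x + y).
Proof.
apply/qpi_eq => /=; rewrite opprD addrACA.
by apply: quot_subD; exact: qrepP.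
Qed.

Lemma qpiN x : qopp (qpi x) = qpi (- x).
Proof.
apply/qpi_eq => /=; rewrite -opprD -[X in N X]add0r.
by apply: quot_subB; [exact: subN.1|exact: qrepP].
Qed.

Lemma qpiZ r x : qscale r (qpi x) = qpi (r *: x).
Proof.
apply/qpi_eq => /=; rewrite -scalerBr -[X in N X]addr0.
by apply: subN.2; [exact: qrepP|exact: subN.1].
Qed.

Let qpi_ind (P : Q -> Prop) : (forall x, P (qpi x)) -> forall a, P a.
Proof. by move=> Ppi a; rewrite -(qpi_val a). Qed.

Fact qaddA : associative qadd.
Proof.
elim/qpi_ind=> x; elim/qpi_ind=> y; elim/qpi_ind=> z.
by rewrite !qpiD addrA.
Qed.
Fact qaddC : commutative qadd.
Proof. by elim/qpi_ind=> x; elim/qpi_ind=> y; rewrite !qpiD addrC. Qed.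
Fact qadd0 : left_id (qpi 0) qadd.
Proof. by elim/qpi_ind=> x; rewrite !qpiD add0r. Qed.
Fact qaddN : left_inverse (qpi 0) qopp qadd.
Proof. by elim/qpi_ind=> x; rewrite qpiN qpiD addNr. Qed.
HB.instance Definition _ := GRing.isZmodule.Build Q qaddA qaddC qadd0 qaddN.

Fact qscaleA (r r' : R) (a : Q) : qscale r (qscale r' a) = qscale (r * r') a.
Proof. by elim/qpi_ind: a => x; rewrite !qpiZ scalerA. Qed.
Fact qscale1 : left_id 1 qscale.
Proof. by elim/qpi_ind=> x; rewrite qpiZ scale1r. Qed.
Fact qscaleDr : right_distributive qscale +%R.
Proof.
move=> r; elim/qpi_ind=> x; elim/qpi_ind=> y.
rewrite -[LHS]/(qscale r (qadd (qpi x) (qpi y))) qpiD qpiZ.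
by rewrite scalerDr -qpiD -!qpiZ.
Qed.
Fact qscaleDl (a : Q) : {morph qscale^~ a : r r' / r + r'}.
Proof.
by move=> r r'; elim/qpi_ind: a => x; rewrite !qpiZ scalerDl -qpiD.
Qed.
HB.instance Definition _ :=
  GRing.Zmodule_isLmodule.Build R Q qscaleA qscale1 qscaleDr qscaleDl.

Fact qpi_is_linear : linear qpi.
Proof. by move=> r x y; rewrite -qpiD -qpiZ. Qed.
HB.instance Definition _ := GRing.isLinear.Build R M Q *:%R qpi qpi_is_linear.

Lemma qpi_eq0 x : qpi x = 0 <-> N x.
Proof. by rewrite -[0]/(qpi 0) qpi_eq subr0. Qed.

Lemma qpi_surj (a : Q) : exists x, qpi x = a.
Proof. by exists (sval a); exact: qpi_val. Qed.

End Quotient.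

(** * A module without a cover *)

Lemma cantor_no_injection (T : Type) (F : set T -> T) : injective F -> False.
Proof.
move=> Finj; pose D := [set x | exists A, x = F A /\ ~ A x].
have nD : ~ D (F D).
  by move=> DF; have [A [/Finj DA nA]] := DF; apply: nA; rewrite -DA.
by apply: (nD); exists D.
Qed.

Section NoCover.
Variables (R : pzRingType) (U : rmodType R).
Hypotheses (artU : artinian U) (uniU : uniserial U).
Variables (s : U) (f : {linear U -> U}) (u0 : U).
Hypothesis socP : forall x, x <> 0 -> exists r : R^c, r *: x = s.
Hypothesis fs : f s = 0.
Hypothesis fmin :
  forall g : {linear U -> U}, g s = 0 -> forall x, f x = 0 -> g x = 0.
Hypothesis u0P : forall n, lpow f n u0 <> 0.

Let fsurj := nonnilpotent_surjective artU uniU u0P.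

Let lpow_surj := lpow_surjective fsurj.

Section Sums.
Variable V : rmodType R.

Fixpoint sum_pow (t : nat -> {linear U -> V}) n : {linear U -> V} :=
  if n is m.+1 then [the {linear U -> V} of sum_pow t m \+ (t m \o lpow f m)]
  else [the {linear U -> V} of \0].

End Sums.

Lemma sum_pow_comp (V W : rmodType R) (h : {linear V -> W})
    (t : nat -> {linear U -> V}) (t' : nat -> {linear U -> W}) n u :
  (forall i v, h (t i v) = t' i v) -> h (sum_pow t n u) = sum_pow t' n u.
Proof.
move=> ht; elim: n => [|n IH] /=; first by rewrite linear0.
by rewrite linearD /= IH ht.
Qed.

Section Cover.
(* There are more indices than sequences in U, hence more than elements of any
   U^T with T finite. *)
Local Notation Y := (set (nat -> U)).
Variables (A : rmodType R) (e : Y -> {linear U -> A}).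
Variable g : (nat -> Y) -> {linear U -> A}.
Hypothesis e_inj : forall y y', e y s = e y' s -> y = y'.
Hypothesis gE : forall phi n v, lpow f n v = 0 ->
  g phi v = sum_pow (e \o phi) n v.

(** [rad] holds because a map t into the kernel with t s <> 0 has a retraction,
    and the complementary idempotent is compatible with c without being
    injective.  [LgE] expresses the lift of g phi on ker f^n: the difference of
    g phi and the partial sum kills ker f^n, so it factors through f^n, and the
    lift of the other factor gives a map into the kernel of c. *)
Lemma no_cover (C : rmodType R) (c : {linear C -> A}) :
  is_cover (Add U) c -> False.
Proof.
move=> [[AddC precover] cover]; have [X [a [r ra]]] := Add_retract AddC.
have a0 z : a z = 0 -> z = 0 by move=> az; rewrite -(ra z) az linear0.
have rad (t : {linear U -> C}) : (forall u, c (t u) = 0) -> t s = 0.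
  move=> ct; apply: contrapT => ts.
  have [x atsx] : exists x, a (t s) x <> 0.
    apply: contrapT => no; apply/ts/a0/dsum_ext => x.
    by apply: contrapT => atsx; apply: no; exists x.
  pose v := [the {linear U -> U} of dcoord x \o (a \o t)].
  have [v' [vK _]] :=
    linear_inv (socle_nonkilled_bijective artU socP (g := v) atsx).
  pose h := [the {linear C -> C} of idfun \- (t \o (v' \o (dcoord x \o a)))].
  have /bij_inj hinj : bijective h.
    by apply: cover => z; rewrite /= linearB /= ct subr0.
  apply/ts/hinj; rewrite linear0 -[LHS]/(t s - t (v' (v s))).
  by rewrite vK subrr.
have rad1 (t : {linear U -> C}) : (forall u, c (t u) = 0) ->
    forall v, f v = 0 -> t v = 0.
  move=> ct v fv; apply/a0/dsum_ext => x.
  apply: (fmin (g := [the {linear U -> U} of dcoord x \o (a \o t)])) fv.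
  by rewrite /= rad // linear0.
have radn n : forall t : {linear U -> C}, (forall u, c (t u) = 0) ->
    forall v, lpow f n v = 0 -> t v = 0.
  elim: n => [|n IH] t ct v; first by move=> /= ->; rewrite linear0.
  have [t' t'E] := linear_factor fsurj (rad1 t ct).
  rewrite lpowSr -t'E; apply: IH => u; have [w <-] := fsurj u.
  by rewrite t'E.
have /choice[L LE] (t : {linear U -> A}) :
    exists t' : {linear U -> C}, forall u, c (t' u) = t u.
  by have [h hE] := precover U t (self_Add U); exists h.
have LgE phi n v : lpow f n v = 0 ->
    L (g phi) v = sum_pow (fun i => L (e (phi i))) n v.
  pose D := [the {linear U -> A} of g phi \- sum_pow (e \o phi) n].
  have [|h hE] := linear_factor (lpow_surj n) (t := D).
    move=> u fu; rewrite -[LHS]/(g phi u - sum_pow (e \o phi) n u).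
    by rewrite (gE _ fu) subrr.
  pose S := sum_pow (fun i => L (e (phi i))) n.
  pose t := [the {linear U -> C} of (L h \o lpow f n) \- (L (g phi) \- S)].
  move=> fv; have : t v = 0.
    apply: (radn n) fv => u.
    rewrite -[t u]/(L h (lpow f n u) - (L (g phi) u - S u)).
    have cS : c (S u) = sum_pow (e \o phi) n u.
      by apply: sum_pow_comp => i w; exact: LE.
    rewrite linearB [c (_ - S u)]linearB /= !LE hE cS.
    by rewrite -[D u]/(g phi u - sum_pow (e \o phi) n u) subrr.
  rewrite -[t v]/(L h (lpow f n v) - (L (g phi) v - S v)) fv linear0 sub0r.
  by move/eqP; rewrite oppr_eq0 subr_eq0 => /eqP.
(* If all supports were in T, then y |-> w + a (L (e y) s) would be an injection
   of Y into the functions from T to U. *)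
have step (T : seq {classic X}) (w : dsum X U) :
    exists yx : Y * X, yx.2 \notin T /\ (w + a (L (e yx.1) s)) yx.2 <> 0.
  apply: contrapT => no.
  have out y x : x \notin T -> (w + a (L (e y) s)) x = 0.
    by move=> xT; apply: contrapT => nz; apply: no; exists (y, x).
  pose F y n := if onth T n is Some x then (w + a (L (e y) s)) x else 0.
  apply: (@cantor_no_injection _ F) => y y' FF.
  apply: e_inj; rewrite -!LE; congr (c _); apply: (can_inj ra).
  apply: (addrI w); apply: dsum_ext => x.
  have [xT|xT] := boolP ((x : {classic X}) \in T); last by rewrite !out.
  have := congr1 (fun k : nat -> U => k (index (x : {classic X}) T)) FF.
  rewrite /F !onthE !(nth_map (x : {classic X})) ?index_mem //.
  by rewrite !nth_index // => /addrI->.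
have /choice[stp stpP] (Tw : seq {classic X} * dsum X U) :
    exists yx : Y * X, yx.2 \notin Tw.1 /\ (Tw.2 + a (L (e yx.1) s)) yx.2 <> 0.
  exact: step.
have /choice[w wE] n := lpow_surj n s.
(* A state lists the coordinates already used, and holds the partial sum of the
   a (L (e (phi i))) f^i; the next index makes a new coordinate of the sum
   nonzero at w n, where f^n (w n) = s and so all later terms vanish. *)
pose next n (st : seq {classic X} * (U -> dsum X U)) :=
  let yx := stp (st.1, st.2 (w n)) in
  (yx.2 :: st.1 : seq {classic X},
   fun u => st.2 u + a (L (e yx.1) (lpow f n u))).
pose st := fix st n := if n is m.+1 then next m (st m)
                       else ([::] : seq {classic X}, fun=> 0 : dsum X U).
pose yx n := stp ((st n).1, (st n).2 (w n)).
pose phi n := (yx n).1; pose xs n : X := (yx n).2.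
have stE n u : (st n).2 u = a (sum_pow (fun i => L (e (phi i))) n u).
  by elim: n => [|n IH] /=; rewrite ?linear0 // linearD /= -IH.
have xs_mem m n : (m < n)%N -> (xs m : {classic X}) \in (st n).1.
  elim: n => // n IH; rewrite ltnS leq_eqVlt => /orP[/eqP ->|/IH mn].
    exact: mem_head.
  by rewrite in_cons mn orbT.
have xs_inj : injective xs.
  have aux m n : (m < n)%N -> xs m <> xs n.
    move=> /xs_mem mn e'; have [+ _] := stpP ((st n).1, (st n).2 (w n)).
    by rewrite -[(stp _).2]/(xs n) -e' mn.
  move=> m n e'; case: (ltngtP m n) => // /aux; first by rewrite e'.
  by rewrite e'.
have nz n : a (L (g phi) u0) (xs n) <> 0.
  pose k := [the {linear U -> U} of dcoord (xs n) \o (a \o L (g phi))].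
  have fw : lpow f n.+1 (w n) = 0 by rewrite /= wE.
  have kw : k (w n) <> 0.
    rewrite -[k _]/(a (L (g phi) (w n)) (xs n)) (LgE _ _ _ fw) /=.
    rewrite linearD /= -stE wE.
    by have [_] := stpP ((st n).1, (st n).2 (w n)).
  change (k u0 <> 0) => ku0.
  (* w n is a multiple of u0, since f^(n+1) kills it. *)
  have [[b wb]|[b ub]] := uniserial_elt uniU u0 (w n).
    by apply: kw; rewrite wb linearZ ku0; exact: scaler0.
  by apply: (u0P (n := n.+1)); rewrite ub linearZ fw; exact: scaler0.
apply: infinite_nat; have := dsum_finite (a (L (g phi) u0)).
move/(finite_preimage (f := xs)) => fin.
apply: sub_finite_set (fin _) => [n _|m n _ _]; [exact: nz|exact: xs_inj].
Qed.

End Cover.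
End NoCover.

(** * The quotient by a union of a chain as a direct limit *)

Section KernelChain.
Variables (R : pzRingType) (M : rmodType R) (N : nat -> set M).
Hypothesis subN : forall n, submodule (N n).
Hypothesis monoN : forall i j, (i <= j)%N -> N i `<=` N j.

Definition chain_union : set M := fun x => exists n, N n x.

Lemma chain_union_submodule : submodule chain_union.
Proof.
split=> [|r x y [i xi] [j yj]]; first by exists 0%N; exact: (subN 0).1.
exists (maxn i j); apply: (subN _).2.
  by apply: monoN xi; exact: leq_maxl.
by apply: monoN yj; exact: leq_maxr.
Qed.

Lemma chain_union_quot (C : rmodType R -> Prop) :
  closed_under_direct_limits C -> (forall n, C (quot (subN n))) ->
  C (quot chain_union_submodule).
Proof.
move=> closedC CN.
pose Q n : rmodType R := quot (subN n).
pose pi n : {linear M -> Q n} := [the {linear M -> Q n} of qpi (subN n)].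
pose A : rmodType R := quot chain_union_submodule.
pose piA : {linear M -> A} :=
  [the {linear M -> A} of qpi chain_union_submodule].
have mapP (i j : nat) (ij : (i <= j)%O) :
    exists h : {linear Q i -> Q j}, forall x, h (pi i x) = pi j x.
  apply: linear_factor; first exact: qpi_surj.
  by move=> x /qpi_eq0 xi; apply/qpi_eq0; apply: monoN xi.
pose phi i j ij := sval (cid (mapP i j ij)).
have phiE i j ij x : phi i j ij (pi i x) = pi j x.
  exact: (svalP (cid (mapP i j ij)) x).
have limP i : exists h : {linear Q i -> A}, forall x, h (pi i x) = piA x.
  apply: linear_factor; first exact: qpi_surj.
  by move=> x /qpi_eq0 xi; apply/qpi_eq0; exists i.
pose g i := sval (cid (limP i)).
have gE i x : g i (pi i x) = piA x := svalP (cid (limP i)) x.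
apply: (closedC _ nat Q phi _ CN A g); first split.
- exact: (inhabits 0%N).
- by move=> i j; exists (maxn i j); rewrite !leEnat leq_maxl leq_maxr.
- by move=> i ii a; have [x <-] := qpi_surj a; exact: phiE.
- move=> i j k ij jk ik a; have [x <-] := qpi_surj a.
  by rewrite -[qpi _ x]/(pi i x) /= !phiE.
split=> [i j ij a|L g' g'co].
  by have [x <-] := qpi_surj a; rewrite -[qpi _ x]/(pi i x) /= phiE !gE.
have g'0 n x : g' n (pi n x) = g' 0%N (pi 0%N x).
  by have /= <- := g'co 0%N n (leq0n n) (pi 0%N x); rewrite phiE.
have [||h hE] := linear_factor (p := piA)
    (t := [the {linear M -> L} of g' 0%N \o pi 0%N]).
- exact: qpi_surj.
- move=> x /qpi_eq0[n xn] /=; rewrite -(g'0 n).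
  have -> : pi n x = 0 by apply/qpi_eq0.
  exact: linear0.
exists h; split=> [i a|h' h'g a].
  have [x <-] := qpi_surj a; rewrite -[qpi _ x]/(pi i x) /= gE hE /=.
  by rewrite -(g'0 i).
have [x <-] := qpi_surj a; rewrite -[qpi _ x]/(piA x).
by rewrite hE /= -h'g /= gE.
Qed.

End KernelChain.

(** * Failure of both properties *)

Section Counterexample.
Variables (R : pzRingType) (U : rmodType R).
Hypotheses (artU : artinian U) (uniU : uniserial U).
Variables (s : U) (f : {linear U -> U}) (u0 : U).
Hypothesis socP : forall x, x <> 0 -> exists r : R^c, r *: x = s.
Hypothesis soc_neq0 : (exists x : U, x <> 0) -> s <> 0.
Hypothesis fs : f s = 0.
Hypothesis fmin :
  forall g : {linear U -> U}, g s = 0 -> forall x, f x = 0 -> g x = 0.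
Hypothesis u0P : forall n, lpow f n u0 <> 0.

Local Notation Y := (set (nat -> U)).
Local Notation Z := (Y + (nat -> Y))%type.
Local Notation M := (dsum Z U).
(* The copies of U that carry the maps e_y, and those that carry the g_phi. *)
Local Notation old y := [the {linear U -> M} of din (inl y)].
Local Notation new phi := [the {linear U -> M} of din (inr phi)].

(** A is the quotient of M by the elements
    v_phi - sum_(i < n) e_(phi i) f^i v for f^n v = 0.  For fixed n these span
    the kernel of the map tau n, which is surjective; so A is the direct limit
    of a chain of quotients of M that are isomorphic to M. *)
Lemma no_cover_module : exists A : rmodType R,
  (closed_under_direct_limits (Add U) -> Add U A) /\
  forall (C : rmodType R) (c : {linear C -> A}), is_cover (Add U) c -> False.
Proof.
pose sum phi n := sum_pow f (fun i => old (phi i)) n.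
have [tau tau_old tau_new] : exists2 tau : nat -> {linear M -> M},
    forall n y u, tau n (din (inl y) u) = din (inl y) u &
    forall n phi u, tau n (din (inr phi) u) =
      sum phi n u + din (inr phi) (lpow f n u).
  exists (fun n => [the {linear _ -> _} of dlift (fun z : Z => match z with
    | inl y => old y
    | inr phi => [the {linear U -> M} of sum phi n \+ (new phi \o lpow f n)]
    end)]).
  - by move=> n y u; rewrite /= dlift_in.
  - by move=> n phi u; rewrite /= dlift_in.
have tau_sum n phi k u : tau n (sum phi k u) = sum phi k u.
  by apply: sum_pow_comp => i v; exact: tau_old.
have fnsurj := lpow_surjective (nonnilpotent_surjective artU uniU u0P).
have tau_surj n m : exists x, tau n x = m.
  elim/dsum_ind: m => [|a b [x xa] [y yb]|[y|phi] u].
  - by exists 0; rewrite linear0.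
  - by exists (x + y); rewrite linearD xa yb.
  - by exists (din (inl y) u); rewrite tau_old.
  - have [v vu] := fnsurj n u; exists (din (inr phi) v - sum phi n v).
    by rewrite linearB /= tau_new tau_sum vu addrC addKr.
have tauS n m : tau n m = 0 -> tau n.+1 m = 0.
  have [psi psi_old psi_new] : exists2 psi : {linear M -> M},
      forall y u, psi (din (inl y) u) = din (inl y) u &
      forall phi u, psi (din (inr phi) u) =
        din (inl (phi n)) u + din (inr phi) (f u).
    exists [the {linear _ -> _} of dlift (fun z : Z => match z with
      | inl y => old y
      | inr phi => [the {linear U -> M} of old (phi n) \+ (new phi \o f)]
      end)].
    - by move=> y u; rewrite /= dlift_in.
    - by move=> phi u; rewrite /= dlift_in.
  have -> : tau n.+1 m = psi (tau n m); last by move=> ->; rewrite linear0.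
  apply: (@dsum_eq _ _ _ _ (tau n.+1) [the {linear _ -> _} of psi \o tau n]).
  move=> [y|phi] u /=; first by rewrite !tau_old psi_old.
  rewrite !tau_new linearD psi_new /= addrA; congr (_ + _ + _).
  by apply/esym/sum_pow_comp => i v; exact: psi_old.
pose N n : set M := fun m => tau n m = 0.
have subN n : submodule (N n).
  split=> [|r x y]; rewrite /N ?linear0 // => xn yn.
  by rewrite linearP /= xn yn scaler0 addr0.
have monoN i j : (i <= j)%N -> N i `<=` N j.
  elim: j => [|j IH]; rewrite leq_eqVlt => /orP[/eqP->//|//].
  by move=> /IH sub x /sub/tauS.
pose subA := chain_union_submodule subN monoN.
exists (quot subA : rmodType R); split.
  move=> limU; apply: (@chain_union_quot _ _ _ subN monoN (Add U) limU) => n.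
  pose piN : {linear M -> quot (subN n)} :=
    [the {linear M -> quot (subN n)} of qpi (subN n)].
  have [||h hE] := linear_factor (p := piN) (t := tau n).
  - exact: qpi_surj.
  - by move=> x /qpi_eq0.
  apply: (@iso_dsum_Add _ _ _ Z h); apply: bijective_of => [a|b].
    have [x <-] := qpi_surj a; rewrite -[qpi _ x]/(piN x) hE => tx.
    by apply/qpi_eq0.
  have [x <-] := tau_surj n b; exists (qpi (subN n) x); exact: hE.
pose piA := [the {linear M -> quot subA} of qpi subA].
move=> C c; apply: (no_cover artU uniU socP fs fmin u0P
    (e := fun y => [the {linear U -> quot subA} of piA \o old y])
    (g := fun phi => [the {linear U -> quot subA} of piA \o new phi])).
- move=> y y' /= /qpi_eq[n]; rewrite /N linearB /= !tau_old.
  move/(congr1 (fun m : M => m (inl y))); rewrite dsumB dinE dsum0.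
  have [//|ne] := pselect (y = y'); rewrite dinN ?subr0; last by move=> [].
  by move=> s0; case: soc_neq0 => //; exists u0 => u00; apply: (u0P (n := 0%N)).
- move=> phi n v fv /=.
  pose e y := [the {linear U -> quot subA} of piA \o old y].
  have <- : piA (sum phi n v) = sum_pow f (e \o phi) n v by exact: sum_pow_comp.
  apply/qpi_eq; exists n; rewrite /N linearB /= tau_new tau_sum fv.
  by rewrite linear0 addr0 subrr.
Qed.

End Counterexample.

Theorem theorem5p6 (R : pzRingType) (U : rmodType R)
    (U_artinian : artinian U) (U_uniserial : uniserial U) :
  covering (Add U) <-> closed_under_direct_limits (Add U).
Proof.
have [s [socP soc_neq0]] := socle_generator U_artinian U_uniserial.
have [f [fs fmin]] := least_kernel U_artinian U_uniserial s.
have [fnil|/existsNP[u0 /forallNP u0P]] :=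
    pselect (forall u, exists n, lpow f n u = 0).
  split=> _.
    exact (nilpotent_closed U_artinian U_uniserial socP soc_neq0 fmin fnil).
  exact (nilpotent_covering U_artinian U_uniserial socP soc_neq0 fmin fnil).
have [A [AddA noA]] :=
  no_cover_module U_artinian U_uniserial socP soc_neq0 fs fmin u0P.
split=> [cov|/AddA{}AddA]; exfalso.
  by have [C [c /noA]] := cov A.
apply: (noA A [the {linear A -> A} of idfun]); split; first split=> //.
  by move=> B' g _; exists g.
by move=> h hE; exists id => a /=; rewrite -[RHS]hE.
Qed.
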